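(* Let $n\ge 3$, let $A_0,A_1,A_2\in\mathbb{R}^{n\times n}$ be symmetric matrices and put $q_i(x)=x^TA_ix$ for $i=0,1,2$. Suppose that there exist $\mu_1,\mu_2\in\mathbb{R}$ with $\mu_1A_1+\mu_2A_2\succ 0$, and that there exists $x^0\in\mathbb{R}^n$ with $q_1(x^0)=1$ and $q_2(x^0)<1$. Then $x^*\in\mathbb{R}^n$ is a strict local non-global minimizer of $$\min_{x\in\mathbb{R}^n}\{q_0(x):\ q_1(x)=1,\ q_2(x)\le 1\}$$ if and only if there exist $\alpha\in\mathbb{R}$ and $\beta>0$ satisfying all of the following: - $(A_0+\alpha A_1+\beta A_2)x^*=0$; - $q_1(x^* )=1$, $q_2(x^* )\le 1$; - $\beta(q_2(x^* )-1)=0$; - $v^T(A_0+\alpha A_1+\beta A_2)v>0$ for all $v\neq 0$ such that $v^TA_1x^*=0$ and $v^TA_2x^*=0$; - $A_0+\alpha A_1+\beta A_2\not\succeq 0$.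
   Context: $M\succ 0$ ($M\succeq 0$) means that the symmetric matrix $M$ is positive definite (positive semidefinite); $M\not\succeq 0$ means that $M$ is not positive semidefinite. A strict local minimizer is a feasible point $x^*$ whose objective value is strictly smaller than that of every other feasible point in some neighbourhood of $x^*$. A strict local non-global minimizer is a strict local minimizer that is not a global minimizer. *)

(* Defs.v *)
From HB Require Import structures.
From mathcomp Require Import all_boot all_order all_algebra.
From mathcomp Require Import all_classical all_reals all_analysis.

Set Implicit Arguments.
Unset Strict Implicit.
Unset Printing Implicit Defensive.

Import Order.TTheory GRing.Theory Num.Theory.
Import numFieldNormedType.Exports.

Local Open Scope classical_set_scope.
Local Open Scope ring_scope.

(* The bilinear form u^T M v; the 1 x 1 product is read off at its entry. *)
Definition bform (R : realType) (n : nat) (M : 'M[R]_n) (u v : 'cV[R]_n) : R :=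
  (u^T *m M *m v) ord0 ord0.

Definition qform (R : realType) (n : nat) (M : 'M[R]_n) (x : 'cV[R]_n) : R :=
  bform M x x.

(* Definiteness of symmetric matrices; symmetry is not part of the predicates
   and is to be assumed separately. *)
Definition posdefmx (R : realType) (n : nat) (M : 'M[R]_n) : Prop :=
  forall v : 'cV[R]_n, v != 0 -> 0 < qform M v.

Definition possemidefmx (R : realType) (n : nat) (M : 'M[R]_n) : Prop :=
  forall v : 'cV[R]_n, 0 <= qform M v.

Definition global_minimizer (R : realType) (T : Type) (f : T -> R) (D : set T)
    (x : T) : Prop :=
  D x /\ forall y, D y -> f x <= f y.

Definition strict_local_minimizer (R : realType) (T : topologicalType)
    (f : T -> R) (D : set T) (x : T) : Prop :=
  D x /\ \forall y \near x, D y -> y != x -> f x < f y.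

Definition strict_local_nonglobal_minimizer (R : realType)
    (T : topologicalType) (f : T -> R) (D : set T) (x : T) : Prop :=
  strict_local_minimizer f D x /\ ~ global_minimizer f D x.

(* Main.v *)
Require Import Defs.
From mathcomp Require Import all_boot all_order all_algebra.
From mathcomp Require Import all_classical all_reals all_analysis.
From mathcomp Require Import ring lra.

Set Implicit Arguments.
Unset Strict Implicit.
Unset Printing Implicit Defensive.

Import Order.TTheory GRing.Theory Num.Theory.
Import numFieldNormedType.Exports.

Local Open Scope classical_set_scope.
Local Open Scope ring_scope.

(** Homogeneity turns the problem into one about two quadratic forms.  Put
    K = A1 - A2 and G = A0 - q0(x) A1.  Rescaling a point y close to x so that
    q1(y) = 1 shows that x is a strict local minimizer exactly when, near x, the
    condition q_K(y) >= 0 forces q_G(y) > 0, except on the ray through x.  So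
    only the forms have to be tested, along polynomial curves through x that are
    never required to stay on the surface q1 = 1
    ([strict_local_min_curve]).

    Necessity.  If every direction v with q_K(v) >= 0 keeps the line x + t v in
    the cone q_K >= 0 for small t of both signs, then adding the values at t and
    -t gives q_G(v) >= 0 on the whole cone, which says that x is a global
    minimizer ([line_feasible_global]).  This happens when q2(x) < 1 and when
    K x = 0, so at a non-global minimizer q2(x) = 1 and K x != 0, and the first
    order condition yields beta >= 0 with M x = 0 for M = G - beta K, which is
    A0 + alpha A1 + beta A2 ([lagrange_multiplier]).  Were M positive
    semidefinite, x would be global.  Everything else comes from one vector,
    provided by [exists_negative_isotropic]: a z transversal to the cone q_K = 0
    at x, lying on that cone, with q_M(z) < 0.  It rules out beta = 0, and it
    gives the strict second order condition ([second_order]): for a tangent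
    vector v there is a curve x + t v + O(t^2) on the cone, with a correction
    along z, on which q_M is t^2 times
      q_M(v) - 2 t k v^T M z + t^2 k^2 q_M(z)
    up to factors tending to 1.  If q_M(v) <= 0, positivity of this for t and
    for -t requires the linear term to be positive for both signs of t, because
    the last term is nonpositive; this is absurd.

    Sufficiency.  Local minimality is the second order sufficient condition;
    strict complementarity beta > 0 makes the critical cone a linear subspace,
    and compactness of the unit sphere makes the estimate uniform over the
    directions ([second_order_sufficient]).  Non-globality is again
    [exists_negative_isotropic]: z satisfies q1(z) = q2(z), the common value is
    positive because a combination of A1 and A2 is positive definite, and after
    rescaling to q1 = q2 = 1 the inequality q_M(z) < 0 reads q0(z) < q0(x)
    ([nonglobal_of_indefinite]). *)

Local Notation feasible A1 A2 :=
  [set y | qform A1 y = 1 /\ qform A2 y <= 1].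

(** * Bilinear and quadratic forms of a matrix *)

Lemma bformDl (R : realType) n (M : 'M[R]_n) u1 u2 v :
  bform M (u1 + u2) v = bform M u1 v + bform M u2 v.
Proof. by rewrite /bform linearD !mulmxDl mxE. Qed.

Lemma bformDr (R : realType) n (M : 'M[R]_n) u v1 v2 :
  bform M u (v1 + v2) = bform M u v1 + bform M u v2.
Proof. by rewrite /bform mulmxDr mxE. Qed.

Lemma bformZl (R : realType) n (M : 'M[R]_n) a u v :
  bform M (a *: u) v = a * bform M u v.
Proof. by rewrite /bform linearZ -!scalemxAl mxE. Qed.

Lemma bformZr (R : realType) n (M : 'M[R]_n) a u v :
  bform M u (a *: v) = a * bform M u v.
Proof. by rewrite /bform -scalemxAr mxE. Qed.

Lemma bformDm (R : realType) n (M N : 'M[R]_n) u v :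
  bform (M + N) u v = bform M u v + bform N u v.
Proof. by rewrite /bform mulmxDr mulmxDl mxE. Qed.

Lemma bformZm (R : realType) n (M : 'M[R]_n) a u v :
  bform (a *: M) u v = a * bform M u v.
Proof. by rewrite /bform -scalemxAr -scalemxAl mxE. Qed.

Lemma bformNm (R : realType) n (M : 'M[R]_n) u v :
  bform (- M) u v = - bform M u v.
Proof. by rewrite -scaleN1r bformZm mulN1r. Qed.

Definition bformE := (bformDl, bformDr, bformZl, bformZr,
  bformDm, bformZm, bformNm).

Lemma bformC (R : realType) n (M : 'M[R]_n) u v :
  M \is symmetricmx -> bform M u v = bform M v u.
Proof.
move=> /is_hermitianmxP; rewrite expr0 scale1r map_mx_id // => symM.
rewrite /bform -[in LHS](trmxK (u^T *m M *m v)) mxE.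
by rewrite !trmx_mul trmxK -symM mulmxA.
Qed.

Lemma symmetricmxD (R : realType) n (M N : 'M[R]_n) :
  M \is symmetricmx -> N \is symmetricmx -> M + N \is symmetricmx.
Proof.
rewrite !is_hermitianmxE !expr0 !scale1r !map_mx_id // => /eqP hM /eqP hN.
by rewrite linearD /= -hM -hN.
Qed.

Lemma symmetricmxZ (R : realType) n (M : 'M[R]_n) a :
  M \is symmetricmx -> a *: M \is symmetricmx.
Proof.
rewrite !is_hermitianmxE !expr0 !scale1r !map_mx_id // => /eqP hM.
by rewrite linearZ /= -hM.
Qed.

Lemma symmetricmxB (R : realType) n (M N : 'M[R]_n) :
  M \is symmetricmx -> N \is symmetricmx -> M - N \is symmetricmx.
Proof.
move=> hM hN; rewrite -scaleN1r.
by apply: symmetricmxD => //; exact: symmetricmxZ.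
Qed.

Lemma bform_ker (R : realType) n (M : 'M[R]_n) u v :
  M *m v = 0 -> bform M u v = 0.
Proof. by move=> Mv; rewrite /bform -mulmxA Mv mulmx0 mxE. Qed.

Lemma bform_nondegenerate (R : realType) n (M : 'M[R]_n) v :
  (forall u, bform M u v = 0) -> M *m v = 0.
Proof.
move=> h; apply/colP => i; have := h (delta_mx i 0).
by rewrite /bform trmx_delta -mulmxA -rowE !mxE.
Qed.

Lemma qformZ (R : realType) n (M : 'M[R]_n) a v :
  qform M (a *: v) = a ^+ 2 * qform M v.
Proof. by rewrite /qform !bformE mulrA expr2. Qed.

Lemma qformD (R : realType) n (M : 'M[R]_n) u v : M \is symmetricmx ->
  qform M (u + v) = qform M u + 2 * bform M v u + qform M v.
Proof. by move=> hM; rewrite /qform !bformE (bformC u v hM); ring. Qed.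

Lemma qformDm (R : realType) n (M N : 'M[R]_n) v :
  qform (M + N) v = qform M v + qform N v.
Proof. exact: bformDm. Qed.

Lemma qformZm (R : realType) n (M : 'M[R]_n) a v :
  qform (a *: M) v = a * qform M v.
Proof. exact: bformZm. Qed.

Lemma qformNm (R : realType) n (M : 'M[R]_n) v : qform (- M) v = - qform M v.
Proof. exact: bformNm. Qed.

Definition qformE := (qformDm, qformZm, qformNm).

Lemma qform0 (R : realType) n (M : 'M[R]_n) : qform M 0 = 0.
Proof. by rewrite -(scale0r (0 : 'cV[R]_n)) qformZ expr0n mul0r. Qed.

Lemma exists_bform_neq0 (R : realType) n (M : 'M[R]_n) v :
  M *m v != 0 -> exists u, bform M u v != 0.
Proof.
move=> /eqP Mv; apply: contrapT => /forallNP h; apply: Mv.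
by apply: bform_nondegenerate => u; have /negP := h u; rewrite negbK => /eqP.
Qed.

(** * Continuity, signs near zero, and compactness of the sphere *)

Lemma cvg_bform (R : realType) n (M : 'M[R]_n) T (F : set_system T)
    {FF : Filter F} (f g : T -> 'cV[R]_n) u v :
  f x @[x --> F] --> u -> g x @[x --> F] --> v ->
  bform M (f x) (g x) @[x --> F] --> bform M u v.
Proof.
move=> fu gv.
have E a b : bform M a b = \sum_j (\sum_i a i 0 * M i j) * b j 0.
  rewrite /bform mxE; apply: eq_bigr => j _; rewrite mxE.
  by congr (_ * _); apply: eq_bigr => i _; rewrite mxE.
rewrite E; under eq_fun do rewrite E.
have C (h : T -> 'cV[R]_n) (w : 'cV[R]_n) i :
    h x @[x --> F] --> w -> h x i 0 @[x --> F] --> w i 0.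
  by move=> hw; exact: (continuous_cvg FF (@coord_continuous R n 1 i 0 w) hw).
refine (cvg_big (@add_continuous R) FF _) => j _.
apply: cvgM; last exact: C.
refine (cvg_big (@add_continuous R) FF _) => i _.
by apply: cvgM; [exact: C | exact: cvg_cst].
Qed.

Lemma quadratic_near0_gt0 (R : realType) (a b c : R) : 0 < a ->
  \forall t \near (0 : R), 0 < a + t * b + t ^+ 2 * c.
Proof.
move=> a0.
have : a + t * b + t ^+ 2 * c @[t --> (0 : R)] --> a + 0 * b + 0 ^+ 2 * c.
  apply: cvgD; first apply: cvgD; first exact: cvg_cst.
    by apply: cvgM; [exact: cvg_id | exact: cvg_cst].
  by apply: cvgM; [exact: exprn_continuous | exact: cvg_cst].
by move/cvgr_gt; apply; rewrite mul0r expr0n mul0r !addr0.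
Qed.

(** Evaluating at both t and -t is how linear terms in t are eliminated
    below. *)
Lemma near0_symmetric (R : realType) (P : set R) :
  (\forall t \near (0 : R), P t) -> exists t : R, [/\ 0 < t, P t & P (- t)].
Proof.
move=> /nbhs_ballP[e /= e0 heP]; exists (e / 2).
split; [exact: divr_gt0| |]; apply: heP; rewrite /ball /= sub0r ?opprK ?normrN;
  by rewrite gtr0_norm ?divr_gt0 //; lra.
Qed.

Lemma first_order_ge0 (R : realType) (b c : R) :
  (\forall t \near (0 : R), 0 < t -> 0 <= t * b + t ^+ 2 * c) -> 0 <= b.
Proof.
move=> h; rewrite leNgt; apply/negP => b0.
have nb : 0 < - b by rewrite oppr_gt0.
have /near0_symmetric[t [t0 [h1 h2] _]] :
    \forall t \near (0 : R), (0 < t -> 0 <= t * b + t ^+ 2 * c) /\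
      0 < - b + t * - c + t ^+ 2 * 0.
  by apply: filterI => //; exact: quadratic_near0_gt0.
have := h1 t0.
have : 0 < t * (- b + t * - c + t ^+ 2 * 0) by exact: mulr_gt0.
by nra.
Qed.

Lemma trmx_continuous (R : realType) m n :
  continuous (trmx : 'M[R]_(m, n) -> 'M[R]_(n, m)).
Proof.
move=> M A /= /(nbhs_ballP M^T)[e /= e0 eA].
apply/nbhs_ballP; exists e => //= N [_ MN].
by apply: eA; split=> // i j; rewrite !mxE; exact: MN.
Qed.

Lemma compact_unit_sphere (R : realType) n :
  compact [set w : 'rV[R]_n | `|w| = 1].
Proof.
apply: bounded_closed_compact.
  by exists 1; split=> // M M1 w /= ->; exact: ltW.
exact: (closed_comp (fun w _ => @norm_continuous R 'rV[R]_n w)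
  (@closed_eq R 1)).
Qed.

(** * A negative vector on the cone *)

(** A vector w with q_M(w) < 0 exists, and the inequality is stable under small
    perturbations, so w can be moved off the hyperplane w^T K x = 0.  Adding a
    multiple of x then changes q_K(w) at a nonzero constant rate, so q_K can be
    made to vanish, while q_M(w) stays the same because x is in the kernel of
    M. *)
Lemma exists_negative_isotropic (R : realType) n (M K : 'M[R]_n) x :
  M \is symmetricmx -> K \is symmetricmx ->
  M *m x = 0 -> qform K x = 0 -> K *m x != 0 -> ~ possemidefmx M ->
  exists z, [/\ bform K z x = 1, qform K z = 0 & qform M z < 0].
Proof.
move=> sM sK Mx qKx Kx /existsNP[w /negP]; rewrite -ltNge => qw.
have [z1 Kz1] := exists_bform_neq0 Kx.
have [w' Kw' qw'] : exists2 w', bform K w' x != 0 & qform M w' < 0.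
  have [Kw|] := eqVneq (bform K w x) 0; last by exists w.
  have nqw : 0 < - qform M w by rewrite oppr_gt0.
  have /near0_symmetric[t [t0 ht _]] :=
    quadratic_near0_gt0 (- 2 * bform M z1 w) (- qform M z1) nqw.
  exists (w + t *: z1).
    by rewrite !bformE Kw add0r mulf_neq0 // gt_eqF.
  by rewrite qformD // qformZ !bformE; lra.
have [w2 Kw2 qw2] : exists2 w2, bform K w2 x = 1 & qform M w2 < 0.
  exists ((bform K w' x)^-1 *: w'); first by rewrite bformZl mulVf.
  by rewrite qformZ pmulr_rlt0 // exprn_even_gt0 //= invr_eq0.
exists (w2 + (- (qform K w2 / 2)) *: x); split.
- by rewrite !bformE Kw2 -/(qform K x) qKx mulr0 addr0.
- by rewrite qformD // qformZ qKx bformZl (bformC x w2 sK) Kw2; field.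
- rewrite qformD // qformZ /qform [bform M (_ *: x) w2]bformC // !bformE.
  by rewrite !(bform_ker _ Mx) !mulr0 !addr0.
Qed.

(** * Strict local minimizers along curves *)

(** Points of a curve through x need not satisfy q1 = 1, but q1 is close to 1
    on them, so dividing by its square root gives points near x.  The
    constraint q2 <= 1 and the comparison with q0(x) become the homogeneous
    conditions q2 <= q1 and q0 > q0(x) q1 on the curve itself; the alternative
    c x accounts for the curve points that are rescaled to x. *)
Lemma strict_local_min_curve (R : realType) n (A0 A1 A2 : 'M[R]_n) x v u :
  strict_local_minimizer (qform A0) (feasible A1 A2) x ->
  \forall t \near (0 : R),
    0 <= qform (A1 - A2) (x + t *: v + t ^+ 2 *: u) ->
    (exists c, x + t *: v + t ^+ 2 *: u = c *: x) \/
    0 < qform (A0 - qform A0 x *: A1) (x + t *: v + t ^+ 2 *: u).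
Proof.
move=> [[q1x q2x] loc].
pose y (t : R) := x + t *: v + t ^+ 2 *: u.
have yx : y t @[t --> (0 : R)] --> x.
  suff : y t @[t --> (0 : R)] --> x + 0 *: v + 0 ^+ 2 *: u.
    by rewrite expr0n !scale0r !addr0.
  apply: cvgD; first apply: cvgD; first exact: cvg_cst.
    by apply: cvgZ; [exact: cvg_id | exact: cvg_cst].
  by apply: cvgZ; [exact: exprn_continuous | exact: cvg_cst].
have qy : qform A1 (y t) @[t --> (0 : R)] --> (1 : R).
  by rewrite -q1x; apply: cvg_bform.
pose s (t : R) := (Num.sqrt (qform A1 (y t)))^-1.
have sy : s t *: y t @[t --> (0 : R)] --> x.
  rewrite -[x in _ --> x]scale1r; apply: cvgZ => //.
  rewrite -invr1 -sqrtr1; apply: cvgV; first by rewrite sqrtr1 oner_neq0.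
  exact: (continuous_cvg _ (@sqrt_continuous R 1) qy).
have q1pos : \forall t \near (0 : R), 0 < qform A1 (y t).
  exact: (cvgr_gt _ qy).
have loc' : \forall t \near (0 : R),
    (qform A1 (s t *: y t) = 1 /\ qform A2 (s t *: y t) <= 1) ->
    s t *: y t != x -> qform A0 x < qform A0 (s t *: y t).
  exact: sy _ loc.
near=> t; rewrite -/(y t) => Ky.
have q1y : 0 < qform A1 (y t) by near: t.
have s2 : s t ^+ 2 * qform A1 (y t) = 1.
  by rewrite /s exprVn sqr_sqrtr ?ltW // mulVf // gt_eqF.
have s0 : 0 < s t by rewrite invr_gt0 sqrtr_gt0.
have [yxE|yxN] := eqVneq (s t *: y t) x.
  left; exists (s t)^-1.
  by rewrite -[X in _ *: X]yxE scalerA mulVf ?scale1r // gt_eqF.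
right.
have : qform A0 x < qform A0 (s t *: y t).
  have : (qform A1 (s t *: y t) = 1 /\ qform A2 (s t *: y t) <= 1) ->
    s t *: y t != x -> qform A0 x < qform A0 (s t *: y t) by near: t.
  apply=> //; split.
    by rewrite qformZ.
  rewrite qformZ -s2 ler_pM2l ?exprn_gt0 //.
  by move: Ky; rewrite !qformE subr_ge0.
rewrite qformZ !qformE => lt0.
have : 0 < s t ^+ 2 * (qform A0 (y t) - qform A0 x * qform A1 (y t)).
  by rewrite mulrBr mulrCA s2 mulr1 subr_gt0.
by rewrite pmulr_rgt0 ?exprn_gt0.
Unshelve. all: by end_near.
Qed.

Lemma local_min_curve (R : realType) n (A0 A1 A2 : 'M[R]_n) x v u :
  strict_local_minimizer (qform A0) (feasible A1 A2) x ->
  \forall t \near (0 : R),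
    0 <= qform (A1 - A2) (x + t *: v + t ^+ 2 *: u) ->
    0 <= qform (A0 - qform A0 x *: A1) (x + t *: v + t ^+ 2 *: u).
Proof.
move=> loc; have [[q1x _] _] := loc.
apply: filterS (strict_local_min_curve v u loc) => t h /h[[c ->]|/ltW //].
by rewrite qformZ !qformE q1x mulr1 subrr mulr0.
Qed.

Lemma local_min_line (R : realType) n (A0 A1 A2 : 'M[R]_n) x v :
  A0 \is symmetricmx -> A1 \is symmetricmx -> A2 \is symmetricmx ->
  strict_local_minimizer (qform A0) (feasible A1 A2) x ->
  \forall t \near (0 : R), 0 <= qform (A1 - A2) (x + t *: v) ->
    0 <= t * (2 * bform (A0 - qform A0 x *: A1) v x) +
         t ^+ 2 * qform (A0 - qform A0 x *: A1) v.
Proof.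
move=> s0 s1 s2 loc; have [[q1x _] _] := loc.
have sG : A0 - qform A0 x *: A1 \is symmetricmx.
  by apply: symmetricmxB => //; exact: symmetricmxZ.
have Gx : qform (A0 - qform A0 x *: A1) x = 0.
  by rewrite !qformE q1x mulr1 subrr.
apply: filterS (local_min_curve v 0 loc) => t; rewrite scaler0 addr0 => h /h.
by rewrite qformD // qformZ bformZl Gx add0r mulrCA.
Qed.

(** The sum of the inequalities at t and -t is 2 t^2 q_G(v) >= 0, so q_G is
    nonnegative on the whole cone q_K >= 0 and not only near x; every feasible
    point lies in that cone. *)
Lemma line_feasible_global (R : realType) n (A0 A1 A2 : 'M[R]_n) x :
  A0 \is symmetricmx -> A1 \is symmetricmx -> A2 \is symmetricmx ->
  strict_local_minimizer (qform A0) (feasible A1 A2) x ->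
  (forall v, 0 <= qform (A1 - A2) v ->
     \forall t \near (0 : R), 0 <= qform (A1 - A2) (x + t *: v)) ->
  global_minimizer (qform A0) (feasible A1 A2) x.
Proof.
move=> s0 s1 s2 loc hK; split; first by case: loc.
move=> y [q1y q2y].
have Ky : 0 <= qform (A1 - A2) y by rewrite !qformE q1y subr_ge0.
have [t [t0 [h1 hK1] [h2 hK2]]] := near0_symmetric
  (filterI (local_min_line y s0 s1 s2 loc) (hK y Ky)).
have : 0 <= t ^+ 2 * qform (A0 - qform A0 x *: A1) y.
  by have := h1 hK1; have := h2 hK2; rewrite sqrrN; lra.
by rewrite pmulr_rge0 ?exprn_gt0 // !qformE q1y mulr1 subr_ge0.
Qed.

(** * Necessity *)

(** Directions pointing strictly into the cone q_K >= 0 at x cannot decrease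
    q_G to first order, so the functional G x is nonnegative on the open half
    space where K x is positive, hence is a nonnegative multiple of K x.  The
    multiplier is read off on a vector z normalized by z^T K x = 1. *)
Lemma lagrange_multiplier (R : realType) n (A0 A1 A2 : 'M[R]_n) x :
  A0 \is symmetricmx -> A1 \is symmetricmx -> A2 \is symmetricmx ->
  strict_local_minimizer (qform A0) (feasible A1 A2) x ->
  qform A2 x = 1 -> (A1 - A2) *m x != 0 ->
  exists2 beta, 0 <= beta &
    (A0 - qform A0 x *: A1 - beta *: (A1 - A2)) *m x = 0.
Proof.
move=> s0 s1 s2 loc q2x; have [[q1x _] _] := loc.
have sK : A1 - A2 \is symmetricmx by exact: symmetricmxB.
have qKx : qform (A1 - A2) x = 0 by rewrite !qformE q1x q2x subrr.
have line v := local_min_line v s0 s1 s2 loc.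
move: (A1 - A2) (A0 - _ *: A1) sK qKx line => K G sK qKx line Kx.
have FO v : 0 < bform K v x -> 0 <= bform G v x.
  move=> k0; suff : 0 <= 2 * bform G v x by rewrite pmulr_rge0.
  apply: (@first_order_ge0 _ _ (qform G v)).
  have k1 : 0 < 2 * bform K v x by rewrite pmulr_rgt0.
  apply: filterS (filterI (line v) (quadratic_near0_gt0 (qform K v) 0 k1)).
  move=> t [h1 h2] t0; apply: h1.
  rewrite qformD // qKx qformZ bformZl.
  by have := mulr_gt0 t0 h2; lra.
have [z1 Kz1] := exists_bform_neq0 Kx.
have [z Kz] : exists z, bform K z x = 1.
  by exists ((bform K z1 x)^-1 *: z1); rewrite bformZl mulVf.
have b0 : 0 <= bform G z x by apply: FO; rewrite Kz.
exists (bform G z x) => //.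
(* A tangent direction becomes a strictly inward one after adding t z. *)
have tangent v : bform K v x = 0 -> 0 <= bform G v x.
  move=> Kv; rewrite leNgt; apply/negP; rewrite -oppr_gt0 => Gv.
  have [t [t0 ht _]] := near0_symmetric
    (quadratic_near0_gt0 (- bform G z x) 0 Gv).
  have : 0 <= bform G (v + t *: z) x.
    by apply: FO; rewrite !bformE Kv Kz add0r mulr1.
  by rewrite !bformE; lra.
apply: bform_nondegenerate => v.
have Kw : bform K (v - bform K v x *: z) x = 0.
  by rewrite -scaleNr !bformE Kz; ring.
have := tangent _ Kw; have := tangent (-1 *: (v - bform K v x *: z)).
rewrite bformZl Kw mulr0 => /(_ erefl).
by rewrite -scaleNr !bformE; lra.
Qed.

(** Weak Lagrangian duality: a feasible point gives beta (q2 - 1) <= 0, so q0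
    is at least q_M - alpha - beta there, with equality at x. *)
Lemma psd_multiplier_global (R : realType) n (A0 A1 A2 : 'M[R]_n) x alpha beta :
  0 <= beta -> qform A1 x = 1 -> qform A2 x = 1 ->
  qform (A0 + alpha *: A1 + beta *: A2) x = 0 ->
  possemidefmx (A0 + alpha *: A1 + beta *: A2) ->
  global_minimizer (qform A0) (feasible A1 A2) x.
Proof.
move=> b0 q1x q2x Mx psd; split; first by rewrite /= q1x q2x.
move=> y [q1y q2y]; have := psd y; move: Mx.
by rewrite !qformE q1x q2x q1y; nra.
Qed.

(** With a = v^T K z and k = q_K(v) / 2, the curve
      y(s) = (1 + s a) x + s ((1 + s a) v - s k z)
    stays on the cone q_K = 0: since z and x are on the cone, v is tangent and
    z^T K x = 1, all terms of q_K(y(s)) cancel.  As M x = 0, only the second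
    summand contributes to q_M(y(s)), which must be positive for small nonzero
    s of both signs; with q_M(z) < 0 this excludes q_M(v) <= 0. *)
Lemma second_order (R : realType) n (A0 A1 A2 : 'M[R]_n) x alpha beta v :
  A1 \is symmetricmx -> A2 \is symmetricmx ->
  (A0 + alpha *: A1 + beta *: A2) \is symmetricmx ->
  strict_local_minimizer (qform A0) (feasible A1 A2) x ->
  qform A2 x = 1 -> (A1 - A2) *m x != 0 ->
  (A0 + alpha *: A1 + beta *: A2) *m x = 0 ->
  ~ possemidefmx (A0 + alpha *: A1 + beta *: A2) ->
  v != 0 -> bform A1 v x = 0 -> bform A2 v x = 0 ->
  0 < qform (A0 + alpha *: A1 + beta *: A2) v.
Proof.
move=> s1 s2 sM loc q2x Kx Mx npsd v0 v1 v2; have [[q1x _] _] := loc.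
have sK : A1 - A2 \is symmetricmx by exact: symmetricmxB.
have qKx : qform (A1 - A2) x = 0 by rewrite !qformE q1x q2x subrr.
have [z [Kz qKz qMz]] := exists_negative_isotropic sM sK Mx qKx Kx npsd.
have Kv : bform (A1 - A2) v x = 0 by rewrite !bformE v1 v2 subrr.
have q0x : qform A0 x = - alpha - beta.
  by have := bform_ker x Mx; rewrite -/(qform _ x) !qformE q1x q2x; lra.
(* M = G - beta K, so both forms agree on the cone q_K = 0. *)
have M_of_G y : qform (A1 - A2) y = 0 ->
    qform (A0 + alpha *: A1 + beta *: A2) y = qform (A0 - qform A0 x *: A1) y.
  by rewrite !qformE q0x => /subr0_eq ->; ring.
have curve v' u := strict_local_min_curve v' u loc.
move: (A1 - A2) (A0 + _ + _) M_of_G sK qKx Kz qKz qMz Kv Kx Mx sM curve npsd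
  => K M M_of_G sK qKx Kz qKz qMz Kv Kx Mx sM curve npsd.
rewrite ltNge; apply/negP => qMv.
pose a := bform K v z; pose k := qform K v / 2.
have [t [t0 [h1 ta1] [h2 ta2]]] := near0_symmetric (filterI
  (curve (a *: x + v) (a *: v + (- k) *: z))
  (quadratic_near0_gt0 a 0 ltr01)).
pose y s := x + s *: (a *: x + v) + s ^+ 2 *: (a *: v + (- k) *: z).
have yE s : y s = (1 + s * a) *: x + s *: ((1 + s * a) *: v + (- (s * k)) *: z).
  by apply/colP => i; rewrite !mxE; ring.
have qKy s : qform K (y s) = 0.
  rewrite yE !(qformD, qformZ, bformE) // qKx qKz (bformC z v sK) -/a Kv Kz.
  by rewrite /k; field.
have qMy s : qform M (y s) = s ^+ 2 * ((1 + s * a) ^+ 2 * qform M v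
    - 2 * (1 + s * a) * (s * k * bform M z v) + (s * k) ^+ 2 * qform M z).
  rewrite yE !(qformD, qformZ, bformE) //.
  by rewrite [qform M x](bform_ker _ Mx) !(bform_ker _ Mx); ring.
(* Were y s on the line through x, pairing with K x would force k = 0 and
   pairing with A1 x would then force v = 0. *)
have notray s : s != 0 -> 1 + s * a != 0 -> ~ exists c, y s = c *: x.
  move=> s_neq0 sa0 [c yc].
  have k0 : k = 0.
    have := congr1 (fun u => bform K u x) yc.
    rewrite yE !bformE Kv Kz -/(qform K x) qKx !mulr0 !add0r mulr1 => /eqP.
    rewrite mulrN oppr_eq0 mulrA mulf_eq0 mulf_eq0 (negbTE s_neq0) /=.
    by move/eqP.
  have c1 : c = 1 + s * a.
    have := congr1 (fun u => bform A1 u x) yc.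
    by rewrite yE k0 !bformE v1 -/(qform A1 x) q1x; lra.
  move: yc; rewrite yE c1 k0 mulr0 oppr0 scale0r addr0 scalerA => /eqP.
  rewrite -subr_eq0 addrAC subrr add0r scaler_eq0 mulf_eq0.
  by rewrite (negbTE s_neq0) (negbTE sa0) (negbTE v0).
have key s : s != 0 -> 0 < 1 + s * a ->
    (0 <= qform K (y s) -> (exists c, y s = c *: x) \/
      0 < qform (A0 - qform A0 x *: A1) (y s)) ->
    s * k * bform M z v < 0.
  move=> s_neq0 sa0 []; first by rewrite qKy.
    by move=> yc; case: (notray s s_neq0 _ yc); rewrite gt_eqF.
  rewrite -M_of_G // qMy pmulr_rgt0 ?exprn_even_gt0 // => h.
  rewrite ltNge; apply/negP => skb.
  have : (1 + s * a) ^+ 2 * qform M v <= 0 by rewrite mulr_ge0_le0 ?sqr_ge0.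
  have : (s * k) ^+ 2 * qform M z <= 0 by rewrite mulr_ge0_le0 ?sqr_ge0 ?ltW.
  have : 0 <= (1 + s * a) * (s * k * bform M z v) by rewrite mulr_ge0 // ltW.
  by lra.
move: ta1 ta2; rewrite !mulr0 !addr0 => ta1 ta2.
have tn0 : t != 0 by rewrite gt_eqF.
have := key t tn0 ta1 h1.
have := key (- t) _ ta2 h2; rewrite oppr_eq0 => /(_ tn0).
by lra.
Qed.

(** The constraint is active and K x != 0, since otherwise small segments
    through x stay in the cone and x is global.  Finally beta != 0: if beta = 0
    then M = G, and moving from x along the negative vector z enters the
    feasible cone while decreasing q_G. *)
Lemma necessity (R : realType) n (A0 A1 A2 : 'M[R]_n) x :
  A0 \is symmetricmx -> A1 \is symmetricmx -> A2 \is symmetricmx ->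
  strict_local_nonglobal_minimizer (qform A0) (feasible A1 A2) x ->
  exists alpha beta : R,
    [/\ 0 < beta, qform A2 x = 1,
    (A0 + alpha *: A1 + beta *: A2) *m x = 0,
    (forall v : 'cV[R]_n, v != 0 -> bform A1 v x = 0 -> bform A2 v x = 0 ->
       0 < qform (A0 + alpha *: A1 + beta *: A2) v) &
    ~ possemidefmx (A0 + alpha *: A1 + beta *: A2)].
Proof.
move=> s0 s1 s2 [loc nglob]; have [[q1x q2x] _] := loc.
have sK : A1 - A2 \is symmetricmx by exact: symmetricmxB.
have qKxE : qform (A1 - A2) x = 1 - qform A2 x by rewrite !qformE q1x.
have {}q2x : qform A2 x = 1.
  apply/eqP; rewrite eq_le q2x leNgt; apply/negP => q2lt; apply: nglob.
  apply: line_feasible_global => // v _.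
  have qK0 : 0 < qform (A1 - A2) x by rewrite qKxE subr_gt0.
  apply: filterS (quadratic_near0_gt0 (2 * bform (A1 - A2) v x)
    (qform (A1 - A2) v) qK0) => t /ltW.
  by rewrite qformD // qformZ bformZl mulrCA.
have qKx : qform (A1 - A2) x = 0 by rewrite qKxE q2x subrr.
have Kx : (A1 - A2) *m x != 0.
  apply/eqP => Kx; apply: nglob; apply: line_feasible_global => // v qKv.
  apply: filterE => t; rewrite qformD // qKx qformZ bform_ker // mulr0 !add0r.
  by rewrite mulr_ge0 ?sqr_ge0.
have [beta b0] := lagrange_multiplier s0 s1 s2 loc q2x Kx.
have -> : A0 - qform A0 x *: A1 - beta *: (A1 - A2) =
    A0 + (- qform A0 x - beta) *: A1 + beta *: A2.
  by apply/matrixP => i j; rewrite !mxE; ring.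
set alpha := _ - beta => Mx.
have sM : A0 + alpha *: A1 + beta *: A2 \is symmetricmx.
  by rewrite !(symmetricmxD, symmetricmxZ).
have npsd : ~ possemidefmx (A0 + alpha *: A1 + beta *: A2).
  by move=> psd; apply: nglob; apply: psd_multiplier_global b0 _ _ _ psd => //;
    exact: (bform_ker x Mx).
exists alpha, beta; split=> //; last first.
  by move=> v v0 v1 v2; exact: (second_order s1 s2 sM loc q2x Kx Mx npsd).
rewrite lt_neqAle b0 andbT eq_sym; apply/eqP => beta0.
have [z [Kz _ qMz]] := exists_negative_isotropic sM sK Mx qKx Kx npsd.
have k2 : 0 < 2 * bform (A1 - A2) z x by rewrite Kz mulr1.
have [t [t0 [h1 h2] _]] := near0_symmetric (filterI
  (local_min_line z s0 s1 s2 loc)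
  (quadratic_near0_gt0 (qform (A1 - A2) z) 0 k2)).
have GM : A0 - qform A0 x *: A1 = A0 + alpha *: A1 + beta *: A2.
  by rewrite /alpha beta0 subr0 scale0r addr0 scaleNr.
have : 0 <= t ^+ 2 * qform (A0 + alpha *: A1 + beta *: A2) z.
  move: h1; rewrite GM (bform_ker _ Mx) !mulr0 add0r; apply.
  rewrite qformD // qKx qformZ bformZl.
  by have := mulr_gt0 t0 h2; lra.
by rewrite pmulr_rge0 ?exprn_gt0 // leNgt qMz.
Qed.

(** * Sufficiency *)

(** Write a nearby point as x + t d with d on the unit sphere and t > 0.  The
    constraints and the increase of q0 are then explicit in t and d:
      q_i(x + t d) = 1 + t (2 d^T A_i x + t q_i(d)),  i = 1, 2,
      q0(x + t d) - q0(x) = t^2 q_M(d) + beta (1 - q2(x + t d))  when q1 = 1.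
    Near a direction d0 with d0^T A1 x != 0 or d0^T A2 x > 0 the points are
    infeasible; if d0^T A2 x < 0 the beta term dominates, being of first order
    in t; if both products vanish, q_M(d0) > 0.  Each case holds in a
    neighbourhood of d0 and for all small t, and compactness of the sphere
    makes the bound on t uniform. *)
Lemma second_order_sufficient (R : realType) n (A0 A1 A2 : 'M[R]_n) x
    alpha beta :
  A1 \is symmetricmx -> A2 \is symmetricmx ->
  (A0 + alpha *: A1 + beta *: A2) \is symmetricmx ->
  0 < beta -> (A0 + alpha *: A1 + beta *: A2) *m x = 0 ->
  qform A1 x = 1 -> qform A2 x = 1 ->
  (forall v : 'cV[R]_n, v != 0 -> bform A1 v x = 0 -> bform A2 v x = 0 ->
     0 < qform (A0 + alpha *: A1 + beta *: A2) v) ->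
  strict_local_minimizer (qform A0) (feasible A1 A2) x.
Proof.
move=> s1 s2 sM b0 Mx q1x q2x sosc; split; first by rewrite /= q1x q2x.
pose M := A0 + alpha *: A1 + beta *: A2.
have q0E y : qform A0 y = qform M y - alpha * qform A1 y - beta * qform A2 y.
  by rewrite /M !qformE; ring.
have qM t d : qform M (x + t *: d) = t ^+ 2 * qform M d.
  rewrite qformD // qformZ [qform M x](bform_ker _ Mx) (bform_ker _ Mx).
  by ring.
have q1E t d :
    qform A1 (x + t *: d) =
    1 + t * (2 * bform A1 d x + t * qform A1 d).
  by rewrite qformD // qformZ bformZl q1x; ring.
have q2E t d :
    qform A2 (x + t *: d) =
    1 + t * (2 * bform A2 d x + t * qform A2 d).
  by rewrite qformD // qformZ bformZl q2x; ring.
pose better (t : R) (w : 'rV[R]_n) := 0 < t ->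
  qform A1 (x + t *: w^T) = 1 -> qform A2 (x + t *: w^T) <= 1 ->
  qform A0 x < qform A0 (x + t *: w^T).
have cover :
    \forall t \near (0 : R), [set w : 'rV[R]_n | `|w| = 1] `<=` better t.
  have /compact_near_coveringP cov := @compact_unit_sphere R n.
  apply: (cov R (nbhs (0 : R)) better) => w0 /= w0N.
  have w0neq0 : w0^T != 0.
    by apply/eqP => /(congr1 trmx); rewrite trmxK trmx0 => w00;
      move: w0N; rewrite w00 normr0 => /eqP; rewrite eq_sym oner_eq0.
  have cd : p.1^T @[p --> (w0, (0 : R))] --> w0^T.
    by apply: continuous_cvg; [exact: trmx_continuous | exact: cvg_fst].
  have ct : p.2 @[p --> (w0, (0 : R))] --> (0 : R) by exact: cvg_snd.
  have slope (N N' : 'M[R]_n) : 2 * bform N p.1^T x + p.2 * qform N' p.1^T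
      @[p --> (w0, (0 : R))] --> 2 * bform N w0^T x.
    have lim : 2 * bform N p.1^T x + p.2 * qform N' p.1^T
        @[p --> (w0, (0 : R))] --> 2 * bform N w0^T x + 0 * qform N' w0^T.
      apply: cvgD; apply: cvgM => //; first exact: cvg_cst.
        exact: (cvg_bform cd (cvg_cst x)).
      exact: (cvg_bform cd cd).
    by move: lim; rewrite mul0r addr0.
  (* Direction leaving the surface q1 = 1 to first order: infeasible nearby. *)
  have [b1|/negP] := boolP (bform A1 w0^T x == 0); last first.
    move=> b1; have {}b1 : 2 * bform A1 w0^T x != 0.
      by rewrite mulf_neq0 ?pnatr_eq0 //; exact/negP.
    near=> p => t0; rewrite q1E => /eqP; rewrite -subr_eq0 addrAC subrr add0r.
    rewrite mulf_eq0 gt_eqF //= => /eqP slope0; exfalso.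
    suff /eqP : 2 * bform A1 p.1^T x + p.2 * qform A1 p.1^T != 0 by apply.
    by near: p; exact: (cvgr_neq0 _ (slope A1 A1) b1).
  have [b2|b2|b2] := ltgtP (bform A2 w0^T x) 0.
  (* Direction entering q2 < 1 to first order: the gain in q0, divided by
     t, tends to - 2 beta d0^T A2 x > 0. *)
  - have gain : p.2 * qform M p.1^T - beta *
        (2 * bform A2 p.1^T x + p.2 * qform A2 p.1^T)
        @[p --> (w0, (0 : R))] -->
        0 * qform M w0^T - beta * (2 * bform A2 w0^T x).
      apply: cvgB; first by apply: cvgM => //; exact: (cvg_bform cd cd).
      by apply: cvgM; [exact: cvg_cst | exact: slope].
    near=> p => t0 q1y q2y.
    rewrite !q0E qM q1y q1x q2x q2E [qform M x](bform_ker _ Mx).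
    have : 0 < p.2 * qform M p.1^T - beta *
        (2 * bform A2 p.1^T x + p.2 * qform A2 p.1^T).
      by near: p; apply: (cvgr_gt _ gain); nra.
    by move=> /(mulr_gt0 t0); lra.
  - near=> p => t0 _; rewrite q2E.
    have : 0 < 2 * bform A2 p.1^T x + p.2 * qform A2 p.1^T.
      by near: p; apply: (cvgr_gt _ (slope A2 A2)); lra.
    by move=> /(mulr_gt0 t0); lra.
  near=> p => t0 q1y q2y.
  rewrite !q0E qM q1y q1x q2x [qform M x](bform_ker _ Mx).
  have : 0 < qform M p.1^T.
    near: p; apply: (cvgr_gt _ (cvg_bform (M := M) cd cd)).
    by apply: sosc => //; exact/eqP.
  by move=> /(mulr_gt0 (exprn_gt0 2 t0)); nra.
have small : `|(y - x)^T| @[y --> x] --> (0 : R).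
  suff : `|(y - x)^T| @[y --> x] --> `|(x - x)^T|.
    by rewrite subrr trmx0 normr0.
  have sub : y - x @[y --> x] --> x - x.
    exact: (cvgB (cvg_id (F:=nbhs x)) (cvg_cst x)).
  have tr := continuous_cvg (nbhs_filter x)
    (@trmx_continuous R n 1 (x - x)) sub.
  exact: (cvg_norm tr).
have near_x : \forall y \near x, [set w : 'rV[R]_n | `|w| = 1] `<=`
    better `|(y - x)^T| by exact: small _ cover.
apply: filterS near_x => y hy [q1y q2y] yx.
have t0 : 0 < `|(y - x)^T|.
  rewrite normr_gt0; apply: contra_neq yx => /(congr1 trmx).
  by rewrite trmxK trmx0 => /subr0_eq.
have := hy (`|(y - x)^T|^-1 *: (y - x)^T) _ t0.
rewrite linearZ /= trmxK scalerA mulfV ?gt_eqF // scale1r subrKC.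
apply=> //.
by rewrite normrZ gtr0_norm ?invr_gt0 // mulVf // gt_eqF.
Unshelve. all: by end_near.
Qed.

(** If K x were zero, the tangent space would be the hyperplane v^T A1 x = 0,
    which is complementary to the kernel vector x, and M would be positive
    semidefinite.  So the isotropic vector z with q_M(z) < 0 exists; positive
    definiteness of mu1 A1 + mu2 A2, evaluated at x and at z, makes mu1 + mu2
    and then the common value q1(z) = q2(z) positive, so that z can be rescaled
    to a feasible point. *)
Lemma nonglobal_of_indefinite (R : realType) n (A0 A1 A2 : 'M[R]_n) x
    alpha beta :
  A1 \is symmetricmx -> A2 \is symmetricmx ->
  (A0 + alpha *: A1 + beta *: A2) \is symmetricmx ->
  (exists mu1 mu2 : R, posdefmx (mu1 *: A1 + mu2 *: A2)) ->
  (A0 + alpha *: A1 + beta *: A2) *m x = 0 ->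
  qform A1 x = 1 -> qform A2 x = 1 ->
  (forall v : 'cV[R]_n, v != 0 -> bform A1 v x = 0 -> bform A2 v x = 0 ->
     0 < qform (A0 + alpha *: A1 + beta *: A2) v) ->
  ~ possemidefmx (A0 + alpha *: A1 + beta *: A2) ->
  ~ global_minimizer (qform A0) (feasible A1 A2) x.
Proof.
move=> s1 s2 sM [mu1 [mu2 pd]] Mx q1x q2x sosc npsd [_ glob].
have sK : A1 - A2 \is symmetricmx by exact: symmetricmxB.
have qKx : qform (A1 - A2) x = 0 by rewrite !qformE q1x q2x subrr.
have Kx : (A1 - A2) *m x != 0.
  apply/eqP => Kx; apply: npsd => v.
  have := sosc (v + (- bform A1 v x) *: x).
  rewrite qformD // qformZ [qform _ x](bform_ker _ Mx) bformZl.
  rewrite (bformC x v sM) (bform_ker v Mx) !mulr0 !addr0 => h.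
  have w1 : bform A1 (v + (- bform A1 v x) *: x) x = 0.
    by rewrite !bformE -/(qform A1 x) q1x; ring.
  have w2 : bform A2 (v + (- bform A1 v x) *: x) x = 0.
    have := bform_ker (v + (- bform A1 v x) *: x) Kx.
    by rewrite bformDm bformNm w1; lra.
  have [wz|w_neq0] := eqVneq (v + (- bform A1 v x) *: x) 0; last first.
    exact: ltW (h _ _ _).
  move/eqP: wz; rewrite scaleNr subr_eq0 => /eqP ->.
  by rewrite qformZ [qform _ x](bform_ker _ Mx) mulr0.
have [z [Kz qKz qMz]] := exists_negative_isotropic sM sK Mx qKx Kx npsd.
have q12z : qform A2 z = qform A1 z.
  by move: qKz; rewrite !qformE => /subr0_eq ->.
have q1z : 0 < qform A1 z.
  have : 0 < qform (mu1 *: A1 + mu2 *: A2) x.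
    by apply: pd; apply/eqP => x0; move: q1x; rewrite x0 qform0; lra.
  have : 0 < qform (mu1 *: A1 + mu2 *: A2) z.
    by apply: pd; apply/eqP => z0; move: qMz; rewrite z0 qform0 ltxx.
  by rewrite !qformE q1x q2x q12z; nra.
pose s := (Num.sqrt (qform A1 z))^-1.
have s2z : s ^+ 2 * qform A1 z = 1.
  by rewrite /s exprVn sqr_sqrtr ?ltW // mulVf // gt_eqF.
have := glob (s *: z).
rewrite /= !qformZ q12z s2z => /(_ (conj erefl (lexx _))).
have := bform_ker x Mx; rewrite -/(qform _ x) !qformE q1x q2x.
have : s ^+ 2 * qform (A0 + alpha *: A1 + beta *: A2) z < 0.
  by rewrite pmulr_rlt0 // exprn_even_gt0 //= invr_eq0 gt_eqF // sqrtr_gt0.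
rewrite !qformE q12z !mulrDr ![s ^+ 2 * (_ * _)]mulrCA s2z.
by lra.
Qed.

Theorem theorem4p4 (R : realType) (n : nat) (A0 A1 A2 : 'M[R]_n)
    (hn : (3 <= n)%N)
    (hA0 : A0 \is symmetricmx) (hA1 : A1 \is symmetricmx)
    (hA2 : A2 \is symmetricmx)
    (hmu : exists mu1 mu2 : R, posdefmx (mu1 *: A1 + mu2 *: A2))
    (hx0 : exists x0 : 'cV[R]_n, qform A1 x0 = 1 /\ qform A2 x0 < 1)
    (xs : 'cV[R]_n) :
  strict_local_nonglobal_minimizer (qform A0)
    [set x : 'cV[R]_n | qform A1 x = 1 /\ qform A2 x <= 1] xs
  <->
  exists alpha beta : R,
    0 < beta /\
    (A0 + alpha *: A1 + beta *: A2) *m xs = 0 /\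
    (qform A1 xs = 1 /\ qform A2 xs <= 1) /\
    beta * (qform A2 xs - 1) = 0 /\
    (forall v : 'cV[R]_n, v != 0 -> bform A1 v xs = 0 -> bform A2 v xs = 0 ->
       0 < qform (A0 + alpha *: A1 + beta *: A2) v) /\
    ~ possemidefmx (A0 + alpha *: A1 + beta *: A2).
Proof.
split=> [slng|[alpha [beta [b0 [Mx [[q1x _] [slack [sosc npsd]]]]]]]].
  have [alpha [beta [b0 q2x Mx sosc npsd]]] := necessity hA0 hA1 hA2 slng.
  have [[[q1x _] _] _] := slng.
  by exists alpha, beta; rewrite q1x q2x subrr mulr0 lexx.
have sM : A0 + alpha *: A1 + beta *: A2 \is symmetricmx.
  by rewrite !(symmetricmxD, symmetricmxZ).
have q2x : qform A2 xs = 1.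
  by move/eqP: slack; rewrite mulf_eq0 gt_eqF // subr_eq0 => /eqP.
split; first exact: second_order_sufficient sM b0 Mx q1x q2x sosc.
exact: nonglobal_of_indefinite sM hmu Mx q1x q2x sosc npsd.
Qed.
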